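(* Let $\mathcal{C}$ be an abelian category and let $F,G:\mathcal{C}\to\mathcal{C}$ be two (additive, covariant) endofunctors such that $(F,G)$ is an adjoint pair, with $F$ left adjoint to $G$, where $\eta:1_{\mathcal{C}}\to GF$ and $\varepsilon:FG\to 1_{\mathcal{C}}$ are the unit and counit, respectively. (i) If $P$ is a projective object in $\mathcal{C}$, then for all $k\in\mathbb{Z}$ the objects $\Sigma^k(1_{F(P)})$ (with $P$ in degree $k$ and $F(P)$ in degree $k+1$) and $\Sigma^k(\eta_P)$ (with $P$ in degree $k$ and $F(P)$ in degree $k+1$) are projective objects in $\mathfrak{L}_F(\mathcal{C})$ and $\mathfrak{R}_G(\mathcal{C})$, respectively. (ii) If $I$ is an injective object in $\mathcal{C}$, then for all $k\in\mathbb{Z}$ the objects $\Sigma^k(\varepsilon_I)$ (with $G(I)$ in degree $k$ and $I$ in degree $k+1$) and $\Sigma^k(1_{G(I)})$ (with $G(I)$ in degree $k$ and $I$ in degree $k+1$) are injective objects in $\mathfrak{L}_F(\mathcal{C})$ and $\mathfrak{R}_G(\mathcal{C})$, respectively.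
   Context: The category $\mathfrak{L}_F(\mathcal{C})$: an object is a family $M=(M^n,d_M^n)_{n\in\mathbb{Z}}$ of objects $M^n$ of $\mathcal{C}$ and morphisms $d_M^n:F(M^n)\to M^{n+1}$ with $d_M^{n+1}\circ F(d_M^n)=0$ for all $n$. A morphism $\varphi:M\to N$ is a family $(\varphi^n:M^n\to N^n)_{n\in\mathbb{Z}}$ with $\varphi^{n+1}\circ d_M^n=d_N^n\circ F(\varphi^n)$ for all $n$. The category $\mathfrak{R}_G(\mathcal{C})$: an object is a family $M=(M^n,d_M^n)_{n\in\mathbb{Z}}$ of objects $M^n$ of $\mathcal{C}$ and morphisms $d_M^n:M^n\to G(M^{n+1})$ with $G(d_M^{n+1})\circ d_M^n=0$ for all $n$. A morphism $\varphi:M\to N$ is a family $(\varphi^n:M^n\to N^n)_{n\in\mathbb{Z}}$ with $G(\varphi^{n+1})\circ d_M^n=d_N^n\circ\varphi^n$ for all $n$. For a morphism $\psi:F(X)\to Y$ (resp. $\psi:X\to G(Y)$) in $\mathcal{C}$, $\Sigma^k(\psi)$ denotes the object of $\mathfrak{L}_F(\mathcal{C})$ (resp. $\mathfrak{R}_G(\mathcal{C})$) with $X$ in degree $k$, $Y$ in degree $k+1$, zero in all other degrees, and $d^k=\psi$. *)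

(* Defs.v *)
From HB Require Import structures.
From mathcomp Require Import all_boot all_order all_algebra.
From mathcomp Require Import boolp.

Set Implicit Arguments.
Unset Strict Implicit.
Unset Printing Implicit Defensive.

Import GRing.Theory.
Local Open Scope ring_scope.

Declare Scope cat_scope.
Delimit Scope cat_scope with cat.

Record category := Category {
  obj :> Type;
  hom : obj -> obj -> Type;
  idm : forall X, hom X X;
  comp : forall X Y Z, hom Y Z -> hom X Y -> hom X Z;
  comp1m : forall X Y (f : hom X Y), comp (idm Y) f = f;
  compm1 : forall X Y (f : hom X Y), comp f (idm X) = f;
  compA : forall X Y Z W (h : hom Z W) (g : hom Y Z) (f : hom X Y),
    comp h (comp g f) = comp (comp h g) f
}.

Arguments hom {c} X Y.
Arguments idm {c} X.
Arguments comp {c X Y Z} g f.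

Notation "g ∘ f" := (comp g f)
  (at level 40, left associativity) : cat_scope.
Open Scope cat_scope.

Section Morphisms.
Variable C : category.

Definition mono (X Y : C) (f : hom X Y) : Prop :=
  forall (A : C) (g h : hom A X), f ∘ g = f ∘ h -> g = h.

Definition epi (X Y : C) (f : hom X Y) : Prop :=
  forall (A : C) (g h : hom Y A), g ∘ f = h ∘ f -> g = h.

Definition projective_object (P : C) : Prop :=
  forall (A B : C) (e : hom A B) (f : hom P B),
    epi e -> exists g : hom P A, e ∘ g = f.

Definition injective_object (I : C) : Prop :=
  forall (A B : C) (m : hom A B) (f : hom A I),
    mono m -> exists g : hom B I, g ∘ m = f.

Definition zero_object (Z : C) : Prop :=
  forall X : C, (exists ! f : hom X Z, True) /\ (exists ! f : hom Z X, True).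

Definition eqm (X Y : C) (e : X = Y) : hom X Y :=
  match e in _ = Z return hom X Z with erefl => idm X end.

End Morphisms.

Record functor (C D : category) := Functor {
  fobj :> C -> D;
  fmap : forall X Y : C, hom X Y -> hom (fobj X) (fobj Y);
  fmap1 : forall X : C, fmap (idm X) = idm (fobj X);
  fmapM : forall (X Y Z : C) (g : hom Y Z) (f : hom X Y),
    fmap (g ∘ f) = fmap g ∘ fmap f
}.

Arguments fmap {C D} F {X Y} f : rename.

Definition id_functor (C : category) : functor C C :=
  @Functor C C (fun X => X) (fun X Y f => f)
    (fun X => erefl) (fun X Y Z g f => erefl).

Section FunctorComposition.
Variables (C D E : category) (G : functor D E) (F : functor C D).

Fact comp_functor1 (X : C) : fmap G (fmap F (idm X)) = idm (G (F X)).
Proof. by rewrite !fmap1. Qed.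

Fact comp_functorM (X Y Z : C) (g : hom Y Z) (f : hom X Y) :
  fmap G (fmap F (g ∘ f)) = fmap G (fmap F g) ∘ fmap G (fmap F f).
Proof. by rewrite !fmapM. Qed.

Definition comp_functor : functor C E :=
  @Functor C E (fun X => G (F X)) (fun X Y f => fmap G (fmap F f))
    comp_functor1 comp_functorM.

End FunctorComposition.

Record nat_trans (C D : category) (F G : functor C D) := NatTrans {
  nt_app :> forall X : C, hom (F X) (G X);
  nt_nat : forall (X Y : C) (f : hom X Y),
    fmap G f ∘ nt_app X = nt_app Y ∘ fmap F f
}.

(* [adjunction F G]: F is left adjoint to G. *)
Record adjunction (C D : category) (F : functor C D) (G : functor D C) :=
Adjunction {
  adj_unit : nat_trans (id_functor C) (comp_functor G F);
  adj_counit : nat_trans (comp_functor F G) (id_functor D);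
  adj_triangleL : forall X : C,
    adj_counit (F X) ∘ fmap F (adj_unit X) = idm (F X);
  adj_triangleR : forall Y : D,
    fmap G (adj_counit Y) ∘ adj_unit (G Y) = idm (G Y)
}.

(* zmodType inherits from choiceType, so hom types get a classical one. *)
HB.instance Definition _ (C : category) (X Y : C) := gen_eqMixin (hom X Y).
HB.instance Definition _ (C : category) (X Y : C) := gen_choiceMixin (hom X Y).

Record zmod_category := ZmodCategory {
  zcat :> category;
  hom_zmod : forall X Y : zcat, GRing.isZmodule (hom X Y)
}.

HB.instance Definition _ (C : zmod_category) (X Y : C) := hom_zmod X Y.

Record preadditive := Preadditive {
  pre_zcat :> zmod_category;
  compDl : forall (X Y Z : pre_zcat) (g h : hom Y Z) (f : hom X Y),
    (g + h) ∘ f = g ∘ f + h ∘ f;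
  compDr : forall (X Y Z : pre_zcat) (g : hom Y Z) (f h : hom X Y),
    g ∘ (f + h) = g ∘ f + g ∘ h
}.

Section PreadditiveTheory.
Variable C : preadditive.

Lemma comp0m (X Y Z : C) (f : hom X Y) : (0 : hom Y Z) ∘ f = 0.
Proof. by apply: (addIr (0 ∘ f)); rewrite -compDl !add0r. Qed.

Lemma compm0 (X Y Z : C) (g : hom Y Z) : g ∘ (0 : hom X Y) = 0.
Proof. by apply: (addIr (g ∘ 0)); rewrite -compDr !add0r. Qed.

Definition is_kernel (X Y K : C) (f : hom X Y) (k : hom K X) : Prop :=
  f ∘ k = 0 /\
  forall (A : C) (g : hom A X), f ∘ g = 0 -> exists ! h : hom A K, k ∘ h = g.

Definition is_cokernel (X Y Q : C) (f : hom X Y) (q : hom Y Q) : Prop :=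
  q ∘ f = 0 /\
  forall (A : C) (g : hom Y A), g ∘ f = 0 -> exists ! h : hom Q A, h ∘ q = g.

Definition is_biproduct (X Y B : C) (i1 : hom X B) (i2 : hom Y B)
    (p1 : hom B X) (p2 : hom B Y) : Prop :=
  [/\ p1 ∘ i1 = idm X, p2 ∘ i2 = idm Y, p1 ∘ i2 = 0, p2 ∘ i1 = 0
    & i1 ∘ p1 + i2 ∘ p2 = idm B].

End PreadditiveTheory.

Record abelian_category := AbelianCategory {
  ab_pre :> preadditive;
  zero_obj : ab_pre;
  zero_objP : zero_object zero_obj;
  ab_biproduct : forall X Y : ab_pre,
    exists (B : ab_pre) (i1 : hom X B) (i2 : hom Y B)
           (p1 : hom B X) (p2 : hom B Y), is_biproduct i1 i2 p1 p2;
  ab_kernel : forall (X Y : ab_pre) (f : hom X Y),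
    exists (K : ab_pre) (k : hom K X), is_kernel f k;
  ab_cokernel : forall (X Y : ab_pre) (f : hom X Y),
    exists (Q : ab_pre) (q : hom Y Q), is_cokernel f q;
  ab_mono_normal : forall (X Y : ab_pre) (f : hom X Y),
    mono f -> exists (Z : ab_pre) (g : hom Y Z), is_kernel g f;
  ab_epi_normal : forall (X Y : ab_pre) (f : hom X Y),
    epi f -> exists (Z : ab_pre) (g : hom Z X), is_cokernel g f
}.

Arguments zero_obj : clear implicits.

Record additive_functor (C D : preadditive) := AdditiveFunctor {
  afun :> functor C D;
  fmapD : forall (X Y : C) (f g : hom X Y),
    fmap afun (f + g) = fmap afun f + fmap afun g
}.

Lemma fmap0 (C D : preadditive) (F : additive_functor C D) (X Y : C) :
  fmap F (0 : hom X Y) = 0.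
Proof. by apply: (addIr (fmap F 0)); rewrite -fmapD !add0r. Qed.

Section LeftCategory.
Variables (C : preadditive) (F : additive_functor C C).

Record Lobj := LObj {
  Lob :> int -> C;
  Ld : forall n : int, hom (F (Lob n)) (Lob (n + 1));
  LdP : forall n : int, Ld (n + 1) ∘ fmap F (Ld n) = 0
}.

Record Lhom (M N : Lobj) := LHom {
  Lmor :> forall n : int, hom (M n) (N n);
  LmorP : forall n : int, Lmor (n + 1) ∘ Ld M n = Ld N n ∘ fmap F (Lmor n)
}.

Lemma Lhom_ext (M N : Lobj) (f g : Lhom M N) : (forall n, f n = g n) -> f = g.
Proof.
case: f g => [f Pf] [g Pg] /= fg.
have E : f = g by apply: functional_extensionality_dep.
by subst g; congr LHom; apply: Prop_irrelevance.
Qed.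

Fact Lid_subproof (M : Lobj) (n : int) :
  idm (M (n + 1)) ∘ Ld M n = Ld M n ∘ fmap F (idm (M n)).
Proof. by rewrite fmap1 comp1m compm1. Qed.

Definition Lid (M : Lobj) : Lhom M M :=
  @LHom M M (fun n => idm (M n)) (@Lid_subproof M).

Fact Lcomp_subproof (M N P : Lobj) (g : Lhom N P) (f : Lhom M N) (n : int) :
  (g (n + 1) ∘ f (n + 1)) ∘ Ld M n = Ld P n ∘ fmap F (g n ∘ f n).
Proof. by rewrite fmapM -compA LmorP !compA LmorP. Qed.

Definition Lcomp (M N P : Lobj) (g : Lhom N P) (f : Lhom M N) : Lhom M P :=
  @LHom M P (fun n => g n ∘ f n) (Lcomp_subproof g f).

Fact Lcomp1m (M N : Lobj) (f : Lhom M N) : Lcomp (Lid N) f = f.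
Proof. by apply: Lhom_ext => n /=; rewrite comp1m. Qed.

Fact Lcompm1 (M N : Lobj) (f : Lhom M N) : Lcomp f (Lid M) = f.
Proof. by apply: Lhom_ext => n /=; rewrite compm1. Qed.

Fact LcompA (M N P Q : Lobj) (h : Lhom P Q) (g : Lhom N P) (f : Lhom M N) :
  Lcomp h (Lcomp g f) = Lcomp (Lcomp h g) f.
Proof. by apply: Lhom_ext => n /=; rewrite compA. Qed.

(* 𝔏_F(C) *)
Definition Lcat : category := Category Lcomp1m Lcompm1 LcompA.

End LeftCategory.

Section RightCategory.
Variables (C : preadditive) (G : additive_functor C C).

Record Robj := RObj {
  Rob :> int -> C;
  Rd : forall n : int, hom (Rob n) (G (Rob (n + 1)));
  RdP : forall n : int, fmap G (Rd (n + 1)) ∘ Rd n = 0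
}.

Record Rhom (M N : Robj) := RHom {
  Rmor :> forall n : int, hom (M n) (N n);
  RmorP : forall n : int, fmap G (Rmor (n + 1)) ∘ Rd M n = Rd N n ∘ Rmor n
}.

Lemma Rhom_ext (M N : Robj) (f g : Rhom M N) : (forall n, f n = g n) -> f = g.
Proof.
case: f g => [f Pf] [g Pg] /= fg.
have E : f = g by apply: functional_extensionality_dep.
by subst g; congr RHom; apply: Prop_irrelevance.
Qed.

Fact Rid_subproof (M : Robj) (n : int) :
  fmap G (idm (M (n + 1))) ∘ Rd M n = Rd M n ∘ idm (M n).
Proof. by rewrite fmap1 comp1m compm1. Qed.

Definition Rid (M : Robj) : Rhom M M :=
  @RHom M M (fun n => idm (M n)) (@Rid_subproof M).

Fact Rcomp_subproof (M N P : Robj) (g : Rhom N P) (f : Rhom M N) (n : int) :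
  fmap G (g (n + 1) ∘ f (n + 1)) ∘ Rd M n = Rd P n ∘ (g n ∘ f n).
Proof. by rewrite fmapM -compA RmorP !compA RmorP. Qed.

Definition Rcomp (M N P : Robj) (g : Rhom N P) (f : Rhom M N) : Rhom M P :=
  @RHom M P (fun n => g n ∘ f n) (Rcomp_subproof g f).

Fact Rcomp1m (M N : Robj) (f : Rhom M N) : Rcomp (Rid N) f = f.
Proof. by apply: Rhom_ext => n /=; rewrite comp1m. Qed.

Fact Rcompm1 (M N : Robj) (f : Rhom M N) : Rcomp f (Rid M) = f.
Proof. by apply: Rhom_ext => n /=; rewrite compm1. Qed.

Fact RcompA (M N P Q : Robj) (h : Rhom P Q) (g : Rhom N P) (f : Rhom M N) :
  Rcomp h (Rcomp g f) = Rcomp (Rcomp h g) f.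
Proof. by apply: Rhom_ext => n /=; rewrite compA. Qed.

(* ℜ_G(C) *)
Definition Rcat : category := Category Rcomp1m Rcompm1 RcompA.

End RightCategory.

Section Sigma.
Variable C : abelian_category.

Definition sigma_ob (k : int) (X Y : C) (n : int) : C :=
  if n == k then X else if n == k + 1 then Y else zero_obj C.

Lemma sigma_ob0 (k : int) (X Y : C) (n : int) :
  n = k -> sigma_ob k X Y n = X.
Proof. by rewrite /sigma_ob => ->; rewrite eqxx. Qed.

Lemma sigma_ob1 (k : int) (X Y : C) (n : int) :
  n = k -> sigma_ob k X Y (n + 1) = Y.
Proof.
by rewrite /sigma_ob => ->; rewrite -subr_eq0 addrAC subrr add0r eqxx.
Qed.

Lemma int_succ_neq (n : int) : n + 1 <> n.
Proof. by move/eqP; rewrite -subr_eq0 addrAC subrr add0r. Qed.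

Section SigmaL.
Variables (F : additive_functor C C) (k : int) (X Y : C) (psi : hom (F X) Y).

(* The differential is psi in degree k, up to the identifications of the
   objects in degrees k and k + 1 with X and Y, and 0 elsewhere. *)
Definition sigmaL_d (n : int) :
    hom (F (sigma_ob k X Y n)) (sigma_ob k X Y (n + 1)) :=
  match n =P k with
  | ReflectT e =>
      eqm (esym (sigma_ob1 X Y e)) ∘ psi ∘ fmap F (eqm (sigma_ob0 X Y e))
  | ReflectF _ => 0
  end.

Fact sigmaL_dP (n : int) : sigmaL_d (n + 1) ∘ fmap F (sigmaL_d n) = 0.
Proof.
rewrite /sigmaL_d; case: (n =P k) => [e|_]; last by rewrite fmap0 compm0.
case: (n + 1 =P k) => [e'|_]; last by rewrite comp0m.
by case: (@int_succ_neq n); rewrite e'.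
Qed.

Definition SigmaL : Lcat F := LObj sigmaL_dP.

End SigmaL.

Section SigmaR.
Variables (G : additive_functor C C) (k : int) (X Y : C) (psi : hom X (G Y)).

Definition sigmaR_d (n : int) :
    hom (sigma_ob k X Y n) (G (sigma_ob k X Y (n + 1))) :=
  match n =P k with
  | ReflectT e =>
      fmap G (eqm (esym (sigma_ob1 X Y e))) ∘ psi ∘ eqm (sigma_ob0 X Y e)
  | ReflectF _ => 0
  end.

Fact sigmaR_dP (n : int) : fmap G (sigmaR_d (n + 1)) ∘ sigmaR_d n = 0.
Proof.
rewrite /sigmaR_d; case: (n =P k) => [e|_]; last by rewrite compm0.
case: (n + 1 =P k) => [e'|_]; last by rewrite fmap0 comp0m.
by case: (@int_succ_neq n); rewrite e'.
Qed.

Definition SigmaR : Rcat G := RObj sigmaR_dP.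

End SigmaR.

End Sigma.

Arguments SigmaL {C} F k X Y psi.
Arguments SigmaR {C} G k X Y psi.

(* Main.v *)
Require Import Defs.
From mathcomp Require Import all_boot all_algebra.
From mathcomp Require Import boolp.
Import Defs.

(** The idea is that the functor evaluating an object of 𝔏_F(C) in degree k has
    adjoints on both sides. A morphism Σ^k(1_{F X}) -> M is forced by its
    component X -> M^k, which may be any morphism: the component in degree
    k + 1 has to be F X -> F M^k -> M^(k+1), and nothing is required beyond
    that because d ∘ F(d) = 0. So Σ^k(1_{F X}) is the value at X of a left
    adjoint of evaluation in degree k ([SigmaL_free]). In the same way a
    morphism M -> Σ^k(ε_X) is forced by its component M^(k+1) -> X, which may
    be any morphism, since the component M^k -> G X has to be the transpose of
    F M^k -> M^(k+1) -> X; so X |-> Σ^k(ε_X) is a right adjoint of evaluation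
    in degree k + 1 ([SigmaL_cofree]).

    A functor with a right adjoint preserves epimorphisms and one with a left
    adjoint preserves monomorphisms, so evaluation preserves both, in every
    degree. Then its left adjoint sends projectives to projectives and its
    right adjoint sends injectives to injectives, which gives the two
    statements about 𝔏_F(C).

    For ℜ_G(C), transposing differentials, M^n -> G M^(n+1) becoming
    F M^n -> M^(n+1), is an isomorphism of categories ℜ_G(C) -> 𝔏_F(C)
    ([sharp_functor]). It sends Σ^k(psi) to Σ^k of the transpose of psi
    ([sharp_SigmaR]); the transpose of η_P is 1_{F P} and that of 1_{G I} is
    ε_I, so the two remaining statements are the same ones transported along
    this isomorphism. *)

Set Implicit Arguments.
Unset Strict Implicit.
Unset Printing Implicit Defensive.

Import GRing.Theory.
Local Open Scope ring_scope.

(** * Free and cofree objects along a functor *)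

Section UniversalArrows.
Variables (D C : category) (E : functor D C).

(** The universal arrow is hidden by an existential, one object at a time, so
    that no adjoint functor has to be built. *)
Definition free_on (X : C) (S : D) : Prop :=
  exists u : hom X (E S), forall (M : D) (f : hom X (E M)),
    exists ! phi : hom S M, fmap E phi ∘ u = f.

Definition cofree_on (X : C) (S : D) : Prop :=
  exists c : hom (E S) X, forall (M : D) (f : hom (E M) X),
    exists ! phi : hom M S, c ∘ fmap E phi = f.

(** Morphisms out of E B transpose to morphisms out of B, where e can be
    cancelled. *)
Lemma cofree_fmap_epi :
    (forall X, exists S, cofree_on X S) ->
  forall (A B : D) (e : hom A B), epi e -> epi (fmap E e).
Proof.
move=> cof A B e epi_e X g h gh.
have [S [c univ]] := cof X.
have [g' [g'E _]] := univ B g; have [h' [h'E _]] := univ B h.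
have [m [_ uniq_m]] := univ A (g ∘ fmap E e).
suff : g' = h' by move=> g'h'; rewrite -g'E -h'E g'h'.
apply: epi_e; rewrite -(uniq_m (g' ∘ e)); last by rewrite fmapM compA g'E.
by apply: uniq_m; rewrite fmapM compA h'E.
Qed.

Lemma free_fmap_mono :
    (forall X, exists S, free_on X S) ->
  forall (A B : D) (m : hom A B), mono m -> mono (fmap E m).
Proof.
move=> fre A B m mono_m X g h gh.
have [S [u univ]] := fre X.
have [g' [g'E _]] := univ A g; have [h' [h'E _]] := univ A h.
have [p [_ uniq_p]] := univ B (fmap E m ∘ g).
suff : g' = h' by move=> g'h'; rewrite -g'E -h'E g'h'.
apply: mono_m; rewrite -(uniq_p (m ∘ g')); last by rewrite fmapM -compA g'E.
by apply: uniq_p; rewrite fmapM -compA h'E.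
Qed.

(** To lift f : S -> B through e, lift its transpose X -> E B through the
    epimorphism E e; the transpose of that lift is a lift of f, by uniqueness
    in the universal property. *)
Lemma free_projective (X : C) (S : D) :
    free_on X S ->
    (forall (A B : D) (e : hom A B), epi e -> epi (fmap E e)) ->
  projective_object X -> projective_object S.
Proof.
move=> [u univ] E_epi projX A B e f epi_e.
have [t tE] := projX _ _ _ (fmap E f ∘ u) (E_epi _ _ _ epi_e).
have [g [gE _]] := univ A t; exists g.
have [p [_ uniq_p]] := univ B (fmap E f ∘ u).
rewrite -(uniq_p f) // -(uniq_p (e ∘ g)) //.
by rewrite fmapM -compA gE.
Qed.

Lemma cofree_injective (X : C) (S : D) :
    cofree_on X S ->
    (forall (A B : D) (m : hom A B), mono m -> mono (fmap E m)) ->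
  injective_object X -> injective_object S.
Proof.
move=> [c univ] E_mono injX A B m f mono_m.
have [t tE] := injX _ _ _ (c ∘ fmap E f) (E_mono _ _ _ mono_m).
have [g [gE _]] := univ B t; exists g.
have [p [_ uniq_p]] := univ A (c ∘ fmap E f).
rewrite -(uniq_p f) // -(uniq_p (g ∘ m)) //.
by rewrite fmapM compA gE.
Qed.

End UniversalArrows.

(** * Transport along an isomorphism of categories *)

Section IsoOfCategories.
Variables (D E : category) (T : functor D E).
Hypothesis T_full : forall (A B : D) (g : hom (T A) (T B)),
  exists f : hom A B, fmap T f = g.
Hypothesis T_faithful : forall (A B : D) (f g : hom A B),
  fmap T f = fmap T g -> f = g.
Hypothesis T_surj : forall N : E, exists M : D, T M = N.

Lemma iso_projective (S : D) : projective_object (T S) -> projective_object S.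
Proof.
move=> projS A B e f epi_e.
have epi_Te : epi (fmap T e).
  move=> N; have [M <-] := T_surj N => g h.
  have [g' <-] := T_full g; have [h' <-] := T_full h.
  by rewrite -!fmapM => /T_faithful/epi_e ->.
have [t] := projS _ _ _ (fmap T f) epi_Te; have [g <-] := T_full t.
by rewrite -fmapM => /T_faithful; exists g.
Qed.

Lemma iso_injective (S : D) : injective_object (T S) -> injective_object S.
Proof.
move=> injS A B m f mono_m.
have mono_Tm : mono (fmap T m).
  move=> N; have [M <-] := T_surj N => g h.
  have [g' <-] := T_full g; have [h' <-] := T_full h.
  by rewrite -!fmapM => /T_faithful/mono_m ->.
have [t] := injS _ _ _ (fmap T f) mono_Tm; have [g <-] := T_full t.
by rewrite -fmapM => /T_faithful; exists g.
Qed.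

End IsoOfCategories.

(** * Transposition along an adjunction *)

Section Transposition.
Variables (C D : category) (F : functor C D) (G : functor D C).
Variable adj : adjunction F G.

Definition sharp (X : C) (Y : D) (f : hom X (G Y)) : hom (F X) Y :=
  adj_counit adj Y ∘ fmap F f.

Definition flat (X : C) (Y : D) (g : hom (F X) Y) : hom X (G Y) :=
  fmap G g ∘ adj_unit adj X.

Lemma sharp_pre (X X' : C) (Y : D) (f : hom X (G Y)) (h : hom X' X) :
  sharp (f ∘ h) = sharp f ∘ fmap F h.
Proof. by rewrite /sharp fmapM compA. Qed.

Lemma sharp_post (X : C) (Y Y' : D) (f : hom X (G Y)) (g : hom Y Y') :
  sharp (fmap G g ∘ f) = g ∘ sharp f.
Proof.
rewrite /sharp fmapM !compA; congr (_ ∘ _).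
by have /= -> := nt_nat (adj_counit adj) g.
Qed.

Lemma flat_pre (X X' : C) (Y : D) (g : hom (F X) Y) (h : hom X' X) :
  flat (g ∘ fmap F h) = flat g ∘ h.
Proof.
rewrite /flat fmapM -!compA; congr (_ ∘ _).
exact: (nt_nat (adj_unit adj) h).
Qed.

Lemma sharpK (X : C) (Y : D) (f : hom X (G Y)) : flat (sharp f) = f.
Proof. by rewrite flat_pre /flat adj_triangleR comp1m. Qed.

Lemma flatK (X : C) (Y : D) (g : hom (F X) Y) : sharp (flat g) = g.
Proof. by rewrite sharp_post /sharp adj_triangleL compm1. Qed.

Lemma sharp_inj (X : C) (Y : D) : injective (@sharp X Y).
Proof. exact: can_inj (@sharpK X Y). Qed.

End Transposition.

Section ZeroTransposition.
Variables (C : preadditive) (F G : additive_functor C C).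
Variable adj : adjunction F G.

Lemma sharp0 (X Y : C) : sharp adj (0 : hom X (G Y)) = 0.
Proof. by rewrite /sharp fmap0 compm0. Qed.

Lemma flat0 (X Y : C) : flat adj (0 : hom (F X) Y) = 0.
Proof. by rewrite /flat fmap0 comp0m. Qed.

End ZeroTransposition.

(** * Right and left categories are isomorphic *)

Section LeftRight.
Variables (C : preadditive) (F G : additive_functor C C).
Variable adj : adjunction F G.

Lemma Lobj_ext (M : int -> C) (d d' : forall n, hom (F (M n)) (M (n + 1)))
    dP d'P :
  (forall n, d n = d' n) -> @LObj C F M d dP = @LObj C F M d' d'P.
Proof.
move=> dd'; have E : d = d' by apply: functional_extensionality_dep.
by subst d'; congr LObj; apply: Prop_irrelevance.
Qed.

Fact sharp_objP (M : Robj G) (n : int) :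
  sharp adj (Rd M (n + 1)) ∘ fmap F (sharp adj (Rd M n)) = 0.
Proof.
by rewrite -sharp_pre -sharp_post RdP sharp0 sharp0.
Qed.

(** On morphisms the functor keeps the components: naturality of
    transposition exchanges the two commutation conditions. *)
Definition sharp_obj (M : Rcat G) : Lcat F := LObj (sharp_objP M).

Fact sharp_homP (M N : Robj G) (f : Rhom M N) (n : int) :
  f (n + 1) ∘ Ld (sharp_obj M) n = Ld (sharp_obj N) n ∘ fmap F (f n).
Proof. by rewrite /= -sharp_pre -sharp_post RmorP. Qed.

Definition sharp_hom (M N : Rcat G) (f : hom M N) :
  hom (sharp_obj M) (sharp_obj N) :=
  @LHom C F (sharp_obj M) (sharp_obj N) (fun n => Rmor f n) (sharp_homP f).

Fact sharp_hom1 (M : Rcat G) : sharp_hom (idm M) = idm (sharp_obj M).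
Proof. exact: Lhom_ext. Qed.

Fact sharp_homM (M N P : Rcat G) (g : hom N P) (f : hom M N) :
  sharp_hom (g ∘ f) = sharp_hom g ∘ sharp_hom f.
Proof. exact: Lhom_ext. Qed.

Definition sharp_functor : functor (Rcat G) (Lcat F) :=
  Functor sharp_hom1 sharp_homM.

Lemma sharp_functor_full (M N : Rcat G)
    (g : hom (sharp_functor M) (sharp_functor N)) :
  exists f : hom M N, fmap sharp_functor f = g.
Proof.
have gP n : fmap G (Lmor g (n + 1)) ∘ Rd M n = Rd N n ∘ Lmor g n.
  apply: (@sharp_inj _ _ _ _ adj); rewrite sharp_post sharp_pre.
  exact: (LmorP g n).
by exists (@RHom C G M N (fun n => Lmor g n) gP); apply: Lhom_ext.
Qed.

Lemma sharp_functor_faithful (M N : Rcat G) (f g : hom M N) :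
  fmap sharp_functor f = fmap sharp_functor g -> f = g.
Proof.
by move=> fg; apply: Rhom_ext => n; apply: (congr1 (fun h => Lmor h n) fg).
Qed.

Lemma sharp_functor_surj (N : Lcat F) : exists M, sharp_functor M = N.
Proof.
have dP n : fmap G (flat adj (Ld N (n + 1))) ∘ flat adj (Ld N n) = 0.
  apply: (@sharp_inj _ _ _ _ adj); rewrite sharp0 sharp_post flatK -flat_pre.
  by rewrite LdP flat0.
exists (RObj dP); case: N dP => M d dP /= rdP.
by apply: Lobj_ext => n /=; rewrite flatK.
Qed.

End LeftRight.

Lemma sharp_SigmaR (C : abelian_category) (F G : additive_functor C C)
    (adj : adjunction F G) (k : int) (X Y : C) (psi : hom X (G Y)) :
  sharp_functor adj (SigmaR G k X Y psi) = SigmaL F k X Y (sharp adj psi).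
Proof.
apply: Lobj_ext => n /=; rewrite /sigmaR_d /sigmaL_d.
case: (n =P k) => [e|_]; last exact: sharp0.
by rewrite sharp_pre sharp_post.
Qed.

(** * Evaluation in a degree and its adjoints *)

Section Evaluation.
Variables (C : preadditive) (F : additive_functor C C) (k : int).

Definition Lev : functor (Lcat F) C :=
  @Functor (Lcat F) C (fun M => Lob M k) (fun M N f => Lmor f k)
    (fun M => erefl) (fun M N P g f => erefl).

End Evaluation.

Section SigmaMorphisms.
Variables (C : abelian_category) (F : additive_functor C C).

Lemma eqmK (X Y : C) (e : X = Y) : eqm (esym e) ∘ eqm e = idm X.
Proof. by case: _ / e; rewrite comp1m. Qed.

Lemma eqmKV (X Y : C) (e : X = Y) : eqm e ∘ eqm (esym e) = idm Y.
Proof. by case: _ / e; rewrite comp1m. Qed.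

Section Components.
Variables (k : int) (X Y : C).

(** The degrees k and k + 1 of a Σ^k object are equal to X and Y, but not
    convertible to them; these four isomorphisms absorb the casts. *)
Definition src_in : hom X (sigma_ob k X Y k) :=
  eqm (esym (sigma_ob0 X Y (erefl k))).
Definition src_out : hom (sigma_ob k X Y k) X := eqm (sigma_ob0 X Y (erefl k)).
Definition tgt_in : hom Y (sigma_ob k X Y (k + 1)) :=
  eqm (esym (sigma_ob1 X Y (erefl k))).
Definition tgt_out : hom (sigma_ob k X Y (k + 1)) Y :=
  eqm (sigma_ob1 X Y (erefl k)).

Lemma src_inK : src_out ∘ src_in = idm X. Proof. exact: eqmKV. Qed.
Lemma src_outK : src_in ∘ src_out = idm _. Proof. exact: eqmK. Qed.
Lemma tgt_inK : tgt_out ∘ tgt_in = idm Y. Proof. exact: eqmKV. Qed.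
Lemma tgt_outK : tgt_in ∘ tgt_out = idm _. Proof. exact: eqmK. Qed.

Lemma sigma_ob_zero (n : int) :
  n <> k -> n <> k + 1 -> zero_object (sigma_ob k X Y n).
Proof.
by rewrite /sigma_ob => /eqP/negPf-> /eqP/negPf->; apply: zero_objP.
Qed.

Variable psi : hom (F X) Y.

Lemma sigmaL_d_src : sigmaL_d k psi k = tgt_in ∘ psi ∘ fmap F src_out.
Proof.
rewrite /sigmaL_d; case: (k =P k) => // e.
by rewrite (Prop_irrelevance e (erefl k)).
Qed.

Lemma sigmaL_d_off (n : int) : n <> k -> sigmaL_d k psi n = 0.
Proof. by rewrite /sigmaL_d; case: (n =P k). Qed.

(** Of the squares to be checked only those starting in degrees k and k + 1
    can be non-trivial: the first hypothesis is the square in degree k, the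
    second says that the differential of M after g vanishes, as Σ^k is zero
    in degree k + 2. *)
Lemma SigmaL_hom_from (M : Lcat F) (f : hom X (Lob M k))
    (g : hom Y (Lob M (k + 1))) :
    g ∘ psi = Ld M k ∘ fmap F f -> Ld M (k + 1) ∘ fmap F g = 0 ->
  exists phi : hom (SigmaL F k X Y psi) M, Lmor phi k ∘ src_in = f.
Proof.
move=> fg dg.
pose phi := dfwith (dfwith (fun n => 0 : hom (sigma_ob k X Y n) (Lob M n))
  (f ∘ src_out)) (g ∘ tgt_out).
have phi1 : phi (k + 1) = g ∘ tgt_out by rewrite /phi dfwith_in.
have phi0 : phi k = f ∘ src_out.
  rewrite /phi dfwith_out ?dfwith_in //; apply/eqP => /int_succ_neq //.
have phi_off n : n <> k -> n <> k + 1 -> phi n = 0.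
  by move=> nk nk1; rewrite /phi !dfwith_out // eq_sym; apply/eqP.
clearbody phi.
have phiP n : phi (n + 1) ∘ sigmaL_d k psi n = Ld M n ∘ fmap F (phi n).
  case: (n =P k) => [->|nk].
    rewrite phi1 phi0 sigmaL_d_src fmapM (compA (Ld M k)) -fg.
    by rewrite !compA -(compA g tgt_out) tgt_inK compm1.
  rewrite sigmaL_d_off // compm0; case: (n =P k + 1) => [->|nk1].
    by rewrite phi1 fmapM compA dg comp0m.
  by rewrite phi_off // fmap0 compm0.
exists (@LHom _ _ (SigmaL F k X Y psi) M phi phiP).
by rewrite /= phi0 -compA src_inK compm1.
Qed.

Lemma SigmaL_hom_from_eq (M : Lcat F) (phi phi' : hom (SigmaL F k X Y psi) M) :
  Lmor phi k = Lmor phi' k -> Lmor phi (k + 1) = Lmor phi' (k + 1) ->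
  phi = phi'.
Proof.
move=> e0 e1; apply: Lhom_ext => n.
case: (n =P k) => [->//|nk]; case: (n =P k + 1) => [->//|nk1].
have [_ [z [_ z_uniq]]] := sigma_ob_zero nk nk1 (Lob M n).
by rewrite -(z_uniq (Lmor phi n)) // -(z_uniq (Lmor phi' n)).
Qed.

Lemma SigmaL_hom_to_eq (M : Lcat F) (phi phi' : hom M (SigmaL F k X Y psi)) :
  Lmor phi k = Lmor phi' k -> Lmor phi (k + 1) = Lmor phi' (k + 1) ->
  phi = phi'.
Proof.
move=> e0 e1; apply: Lhom_ext => n.
case: (n =P k) => [->//|nk]; case: (n =P k + 1) => [->//|nk1].
have [[z [_ z_uniq]] _] := sigma_ob_zero nk nk1 (Lob M n).
by rewrite -(z_uniq (Lmor phi n)) // -(z_uniq (Lmor phi' n)).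
Qed.

End Components.

(** The degree is written j + 1 so that the differential arriving in it is
    Ld M j, which f must kill because the target is zero in degree j. *)
Lemma SigmaL_hom_to (j : int) (X Y : C) (psi : hom (F X) Y) (M : Lcat F)
    (f : hom (Lob M (j + 1)) X) (g : hom (Lob M (j + 1 + 1)) Y) :
    g ∘ Ld M (j + 1) = psi ∘ fmap F f -> f ∘ Ld M j = 0 ->
  exists phi : hom M (SigmaL F (j + 1) X Y psi),
    tgt_out (j + 1) X Y ∘ Lmor phi (j + 1 + 1) = g.
Proof.
set k := j + 1 => fg fd.
pose phi := dfwith (dfwith (fun n => 0 : hom (Lob M n) (sigma_ob k X Y n))
  (src_in k X Y ∘ f)) (tgt_in k X Y ∘ g).
have phi1 : phi (k + 1) = tgt_in k X Y ∘ g by rewrite /phi dfwith_in.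
have phi0 : phi k = src_in k X Y ∘ f.
  rewrite /phi dfwith_out ?dfwith_in //; apply/eqP => /int_succ_neq //.
have phi_off n : n <> k -> n <> k + 1 -> phi n = 0.
  by move=> nk nk1; rewrite /phi !dfwith_out // eq_sym; apply/eqP.
clearbody phi.
have phiP n : phi (n + 1) ∘ Ld M n = sigmaL_d k psi n ∘ fmap F (phi n).
  case: (n =P k) => [->|nk].
    rewrite phi1 phi0 sigmaL_d_src -!compA fg.
    by rewrite -fmapM (compA (src_out _ _ _)) src_inK comp1m.
  rewrite sigmaL_d_off // comp0m; case: (n =P j) => [->|nj].
    by rewrite phi0 -compA fd compm0.
  by rewrite phi_off ?comp0m // => /addIr.
exists (@LHom _ _ M (SigmaL F k X Y psi) phi phiP).
by rewrite /= phi1 compA tgt_inK comp1m.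
Qed.

(** The component in degree k + 1 is determined by the one in degree k since
    the differential 1_{F X} of the source is an isomorphism. *)
Lemma SigmaL_free (k : int) (X : C) :
  free_on (Lev F k) X (SigmaL F k X (F X) (idm (F X))).
Proof.
exists (src_in k X (F X)) => M f.
have [||phi phiE] := @SigmaL_hom_from k X (F X) (idm (F X)) M f
  (Ld M k ∘ fmap F f).
- by rewrite compm1.
- by rewrite fmapM compA LdP comp0m.
exists phi; split=> // phi' phi'E; have e0 : Lmor phi k = Lmor phi' k.
  by rewrite -[LHS]compm1 -[RHS]compm1 -src_outK !compA phiE -phi'E.
apply: SigmaL_hom_from_eq (e0) _.
have dE (h : hom (SigmaL F k X (F X) (idm _)) M) :
    Lmor h (k + 1) = Ld M k ∘ fmap F (Lmor h k) ∘ fmap F (src_in k X (F X))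
      ∘ tgt_out k X (F X).
  rewrite -LmorP /= sigmaL_d_src compm1 -!compA (compA (fmap F _)) -fmapM.
  by rewrite src_inK fmap1 comp1m tgt_outK compm1.
by rewrite (dE phi) (dE phi') e0.
Qed.

(** The component in degree j + 1 is determined by the one in degree j + 2
    since its transpose is the counit composed with its image under F. *)
Lemma SigmaL_cofree (G : additive_functor C C) (adj : adjunction F G)
    (j : int) (X : C) :
  cofree_on (Lev F (j + 1 + 1)) X
    (SigmaL F (j + 1) (G X) X (adj_counit adj X)).
Proof.
exists (tgt_out (j + 1) (G X) X) => M g.
have [||phi phiE] := @SigmaL_hom_to j (G X) X (adj_counit adj X) M
  (flat adj (g ∘ Ld M (j + 1))) g.
- by rewrite -[RHS]/(sharp adj _) flatK.
- by rewrite -flat_pre -compA LdP compm0 flat0.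
exists phi; split=> // phi' phi'E.
have e1 : Lmor phi (j + 1 + 1) = Lmor phi' (j + 1 + 1).
  by rewrite -[LHS]comp1m -[RHS]comp1m -tgt_outK -!compA phiE -phi'E.
apply: SigmaL_hom_to_eq (e1).
have dE (h : hom M (SigmaL F (j + 1) (G X) X (adj_counit adj X))) :
    sharp adj (src_out (j + 1) (G X) X ∘ Lmor h (j + 1)) =
    tgt_out (j + 1) (G X) X ∘ Lmor h (j + 1 + 1) ∘ Ld M (j + 1).
  have /= hP := LmorP h (j + 1).
  rewrite /sharp fmapM -[RHS]compA hP sigmaL_d_src !compA tgt_inK.
  by rewrite comp1m.
have /sharp_inj e0 : sharp adj (src_out (j + 1) (G X) X ∘ Lmor phi (j + 1))
    = sharp adj (src_out (j + 1) (G X) X ∘ Lmor phi' (j + 1)).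
  by rewrite (dE phi) (dE phi') e1.
by rewrite -[LHS]comp1m -[RHS]comp1m -src_outK -!compA e0.
Qed.

Lemma Lev_mono (k : int) (A B : Lcat F) (m : hom A B) :
  mono m -> mono (fmap (Lev F k) m).
Proof.
by apply: free_fmap_mono => X; eexists; apply: SigmaL_free.
Qed.

(** Here the adjunction is used: the cofree objects of evaluation in degree k
    are the Σ^(k-1)(ε_X). *)
Lemma Lev_epi (G : additive_functor C C) (adj : adjunction F G) (k : int)
    (A B : Lcat F) (e : hom A B) :
  epi e -> epi (fmap (Lev F k) e).
Proof.
(* Writes the degree as j + 1 + 1 with j = k - 2, the form cofreeness has. *)
rewrite -(subrK 1 k) -(subrK 1 (k - 1)).
by apply: cofree_fmap_epi => X; eexists; apply: SigmaL_cofree adj _ _.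
Qed.

Lemma SigmaL_projective (G : additive_functor C C) (adj : adjunction F G)
    (k : int) (P : C) :
  projective_object P -> projective_object (SigmaL F k P (F P) (idm (F P))).
Proof.
move=> projP; apply: (free_projective (SigmaL_free k P) _ projP).
exact: (Lev_epi adj).
Qed.

Lemma SigmaL_injective (G : additive_functor C C) (adj : adjunction F G)
    (k : int) (I : C) :
  injective_object I ->
  injective_object (SigmaL F k (G I) I (adj_counit adj I)).
Proof.
rewrite -(subrK 1 k) => injI.
apply: (cofree_injective (SigmaL_cofree adj (k - 1) I) _ injI).
exact: Lev_mono.
Qed.

End SigmaMorphisms.

Theorem theorem4p1 (C : abelian_category) (F G : additive_functor C C)
    (adj : adjunction F G) :
  (forall P : C, projective_object P -> forall k : int,
     projective_object (SigmaL F k P (F P) (idm (F P))) /\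
     projective_object (SigmaR G k P (F P) (adj_unit adj P)))
  /\
  (forall I : C, injective_object I -> forall k : int,
     injective_object (SigmaL F k (G I) I (adj_counit adj I)) /\
     injective_object (SigmaR G k (G I) I (idm (G I)))).
Proof.
have fl := @sharp_functor_full C F G adj.
have ff := @sharp_functor_faithful C F G adj.
have sj := @sharp_functor_surj C F G adj.
split=> [P projP k | I injI k]; split.
- exact: SigmaL_projective adj k P projP.
- apply: (iso_projective fl ff sj); rewrite sharp_SigmaR.
  by rewrite /sharp adj_triangleL; apply: SigmaL_projective adj k P projP.
- exact: SigmaL_injective.
apply: (iso_injective fl ff sj); rewrite sharp_SigmaR.
by rewrite /sharp fmap1 compm1; apply: SigmaL_injective.
Qed.
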